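(* For all positive integers $a,b$, the ideal of the monomial curve $(t^{a},t^{a+2b},t^{2a+3b},t^{2a+5b})$, i.e. the toric ideal $I_{M_{a,b}}\subseteq K[x_1,x_2,x_3,x_4]$ of the row matrix $M_{a,b}=(a,\,a+2b,\,2a+3b,\,2a+5b)$, is a set-theoretic complete intersection. In particular the ideal of the monomial curve $(t^4,t^6,t^{11},t^{13})$ is a set-theoretic complete intersection.
   Context: $K$ is a field. For a row matrix $(a_1,\dots,a_n)$ of positive integers, its toric ideal is the kernel of $K[x_1,\dots,x_n]\to K[t]$, $x_i\mapsto t^{a_i}$. An ideal $I$ is a set-theoretic complete intersection if $I=\mathrm{rad}(g_1,\dots,g_h)$ for some $h=\mathrm{ht}(I)$ polynomials (here $h=3$). *)

(* Defs.v *)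
From mathcomp Require Import all_boot all_algebra.
From mathcomp Require Import mpoly.
Set Implicit Arguments. Unset Strict Implicit. Unset Printing Implicit Defensive.
Import GRing.Theory.
Local Open Scope ring_scope.

Definition toric_ideal (K : fieldType) (n : nat) (w : 'I_n -> nat)
  (p : {mpoly K[n]}) : Prop :=
  mmap (@polyC K) (fun i => 'X^(w i)) p = 0.

Definition in_ideal (K : fieldType) (n : nat) (gs : seq {mpoly K[n]})
  (p : {mpoly K[n]}) : Prop :=
  exists cs : seq {mpoly K[n]},
    size cs = size gs /\ p = \sum_(i < size gs) cs`_i * gs`_i.

Definition in_radical (K : fieldType) (n : nat) (gs : seq {mpoly K[n]})
  (p : {mpoly K[n]}) : Prop :=
  exists k : nat, in_ideal gs (p ^+ k).

Definition is_set_theoretic_CI_with (K : fieldType) (n h : nat)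
  (I : {mpoly K[n]} -> Prop) : Prop :=
  exists gs : seq {mpoly K[n]}, size gs = h /\
    forall p, I p <-> in_radical gs p.

Definition Mab (a b : nat) (i : 'I_4) : nat :=
  nth 0%N [:: a; (a + 2 * b)%N; (2 * a + 3 * b)%N; (2 * a + 5 * b)%N] i.

(* Main.v *)
(** Write x1 = s, x2 = s u^2, x3 = s^2 u^3, x4 = s^2 u^5; the curve lies on this
    toric surface S, as the locus s = t^a, u = t^b.  S is cut out by the 2x2
    minors of [[x2, x1, x3], [x4, x3, x2^3]], whose last two columns form a
    symmetric block.  Hence two equations suffice set-theoretically: the
    determinant F1 = x1 x2^3 - x3^2 of that block, and the value
    F2 = x1 x4^2 - 2 x2 x3 x4 + x2^5 of its quadratic form at (x4, - x2).
    With g = gcd(a, b), a = g a', b = g b', the torus part of the curve is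
    s^b' = u^a' on S.  The function s^(2a') (s^b' - u^a')^5 equals
    x1^(5b'+2a') and - x4^a' on the two boundary rays of S, so it vanishes
    there only at the origin.  All its terms are monomials in the x_i as soon
    as a' >= 2, because the only points of the cone missing from the semigroup
    are the s^i u; it is therefore the third equation.  For a' = 1 the curve is
    a graph over the x1-axis and a complete intersection.

    To stay over an arbitrary field, vanishing is replaced by membership in the
    radical R of the three equations.  In the colon ideal Q = (R : x2), which
    plays the role of the torus, every x_i can be cancelled. *)

Require Import Defs.
From mathcomp Require Import all_boot all_algebra ring zify.
From mathcomp Require Import mpoly.
Set Implicit Arguments.
Unset Strict Implicit.
Unset Printing Implicit Defensive.
Import GRing.Theory.
Local Open Scope ring_scope.

(** * Radical ideals as predicates: closure, congruences, colon ideals and cancellation *)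

Definition radical_ideal (A : comNzRingType) (Q : A -> Prop) :=
  [/\ Q 0, forall p q, Q p -> Q q -> Q (p + q), forall c p, Q p -> Q (c * p)
    & forall p n, Q (p ^+ n) -> Q p].

Section RadicalIdeal.
Variables (A : comNzRingType) (Q : A -> Prop).
Hypothesis radQ : radical_ideal Q.
Implicit Types p q c : A.

Lemma rad0 : Q 0.
Proof. by case: radQ. Qed.

Lemma radD p q : Q p -> Q q -> Q (p + q).
Proof. by case: radQ => _ + _ _; apply. Qed.

Lemma radMl c p : Q p -> Q (c * p).
Proof. by case: radQ => _ _ + _; apply. Qed.

Lemma radX p n : Q (p ^+ n) -> Q p.
Proof. by case: radQ => _ _ _; apply. Qed.

Lemma radMr c p : Q p -> Q (p * c).
Proof. by rewrite mulrC; apply: radMl. Qed.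

Lemma radN p : Q p -> Q (- p).
Proof. by rewrite -mulN1r; apply: radMl. Qed.

Lemma radB p q : Q p -> Q q -> Q (p - q).
Proof. by move=> Qp Qq; apply/radD/radN. Qed.

Lemma rad_sum (I : Type) (s : seq I) (P : pred I) (F : I -> A) :
  (forall i, P i -> Q (F i)) -> Q (\sum_(i <- s | P i) F i).
Proof.
by move=> QF; apply: big_ind; [exact: rad0 | exact: radD | exact: QF].
Qed.

Lemma rad_congM p p' q q' : Q (p - p') -> Q (q - q') -> Q (p * q - p' * q').
Proof.
move=> Qp Qq; have -> : p * q - p' * q' = (p - p') * q + p' * (q - q') by ring.
by apply: radD; [exact: radMr | exact: radMl].
Qed.

Lemma rad_congX p q n : Q (p - q) -> Q (p ^+ n - q ^+ n).
Proof. by move=> Qpq; rewrite subrXX; exact: radMr. Qed.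

Lemma rad_colon c : radical_ideal (fun p => Q (c * p)).
Proof.
split=> [|p q Qp Qq|d p Qp|p n Qp].
- by rewrite mulr0; exact: rad0.
- by rewrite mulrDr; exact: radD.
- by rewrite mulrCA; exact: radMl.
- apply: (@radX _ n.+1).
  have -> : (c * p) ^+ n.+1 = c ^+ n * p * (c * p ^+ n).
    by rewrite exprMn !exprS; ring.
  exact: radMl.
Qed.

Lemma rad_cancelX c p n :
  (forall q, Q (c * q) -> Q q) -> Q (c ^+ n * p) -> Q p.
Proof.
move=> cancel_c; elim: n => [|n IHn]; first by rewrite mul1r.
by rewrite exprS -mulrA => /cancel_c.
Qed.

Lemma radXl c p n : Q (c ^+ n * p) -> Q (c * p).
Proof.
move=> Qcp; apply: (@radX _ n.+1).
have -> : (c * p) ^+ n.+1 = c * p ^+ n * (c ^+ n * p).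
  by rewrite exprMn !exprS; ring.
exact: radMl.
Qed.

End RadicalIdeal.

(** * The toric surface and the curve on it, over any commutative ring *)

Section Surface.
Variables (A : comNzRingType) (x1 x2 x3 x4 : A).

(* On S one has u = x3 / (x1 x2), so a monomial s^i u^j is
   x1^i x3^j / (x1 x2)^j. *)
Lemma surface_monomial (Q : A -> Prop) (m1 m2 m3 m4 : nat) :
  radical_ideal Q -> Q (x1 * x4 - x2 * x3) -> Q (x1 * x2 ^+ 3 - x3 ^+ 2) ->
  let j := (2 * m2 + 3 * m3 + 5 * m4)%N in
  Q (x1 ^+ m1 * x2 ^+ m2 * x3 ^+ m3 * x4 ^+ m4 * (x1 * x2) ^+ j
     - x1 ^+ (m1 + m2 + 2 * m3 + 2 * m4) * x3 ^+ j).
Proof.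
move=> radQ Qf Qg j.
have Q2 : Q (x2 * (x1 * x2) ^+ 2 - x1 * x3 ^+ 2).
  have -> : x2 * (x1 * x2) ^+ 2 - x1 * x3 ^+ 2
    = x1 * (x1 * x2 ^+ 3 - x3 ^+ 2) by ring.
  exact: radMl.
have Q3 : Q (x3 * (x1 * x2) ^+ 3 - x1 ^+ 2 * x3 ^+ 3).
  have -> : x3 * (x1 * x2) ^+ 3 - x1 ^+ 2 * x3 ^+ 3
    = x1 ^+ 2 * x3 * (x1 * x2 ^+ 3 - x3 ^+ 2) by ring.
  exact: radMl.
have Q4 : Q (x4 * (x1 * x2) ^+ 5 - x1 ^+ 2 * x3 ^+ 5).
  have -> : x4 * (x1 * x2) ^+ 5 - x1 ^+ 2 * x3 ^+ 5
    = x1 ^+ 4 * x2 ^+ 5 * (x1 * x4 - x2 * x3)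
      + x1 ^+ 2 * x3 * (x1 * x2 ^+ 3 + x3 ^+ 2) * (x1 * x2 ^+ 3 - x3 ^+ 2).
    by ring.
  by apply: radD => //; exact: radMl.
have := rad_congM radQ (rad_congM radQ (rad_congX radQ m2 Q2)
          (rad_congX radQ m3 Q3)) (rad_congX radQ m4 Q4).
move/(radMl radQ (x1 ^+ m1)); congr Q.
by rewrite /j !exprD !exprMn; ring.
Qed.

(* The expansion of s^(2a) (s^b - u^a)^5, with s^(2a) u^a written as
   x1^e x2^f x3^h where 2f + 3h = a and e + f + 2h = 2a. *)
Definition curve_eq (a b e f h : nat) : A :=
  x1 ^+ b ^+ 5 * x1 ^+ a ^+ 2
  - 5%:R * x1 ^+ b ^+ 4 * (x1 ^+ e * x2 ^+ f * x3 ^+ h)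
  + 10%:R * x1 ^+ b ^+ 3 * (x1 ^+ a * x2 ^+ a)
  - 10%:R * x1 ^+ b ^+ 2 * x3 ^+ a
  + 5%:R * x1 ^+ b * x2 ^+ a ^+ 2 - x4 ^+ a.

(** Away from x2 = 0 the three equations give s^b = u^a, which identifies monomials of equal weight;
    so x2 times the binomial lies in [R]. The factor x2 is then removed by a study of the boundary
    rays, where [curve_eq] leaves only the origin. *)
Lemma curve_binomial (R : A -> Prop) (a b e f h : nat) :
  radical_ideal R -> (0 < a)%N -> (0 < b)%N -> coprime a b ->
  (2 * f + 3 * h = a)%N -> (e + f + 2 * h = 2 * a)%N ->
  R (x1 * x2 ^+ 3 - x3 ^+ 2) ->
  R (x1 * x4 ^+ 2 - 2%:R * x2 * x3 * x4 + x2 ^+ 5) ->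
  R (curve_eq a b e f h) ->
  forall m1 m2 m3 m4 n1 n2 n3 n4 : nat,
  (a * (m1 + m2 + 2 * m3 + 2 * m4) + b * (2 * m2 + 3 * m3 + 5 * m4) =
   a * (n1 + n2 + 2 * n3 + 2 * n4) + b * (2 * n2 + 3 * n3 + 5 * n4))%N ->
  R (x1 ^+ m1 * x2 ^+ m2 * x3 ^+ m3 * x4 ^+ m4
     - x1 ^+ n1 * x2 ^+ n2 * x3 ^+ n3 * x4 ^+ n4).
Proof.
move=> radR a0 b0 cop_ab def_a def_2a RF1 RF2 RF3.
(* Completing the square: F2 times a diagonal entry of the block, x1 or x2^3, is the square of
   another minor plus a multiple of F1. *)
have Rf1 : R (x1 * x4 - x2 * x3).
  apply: (radX radR (n := 2)).
  have -> : (x1 * x4 - x2 * x3) ^+ 2 =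
      x1 * (x1 * x4 ^+ 2 - 2%:R * x2 * x3 * x4 + x2 ^+ 5)
      - x2 ^+ 2 * (x1 * x2 ^+ 3 - x3 ^+ 2) by ring.
  by apply: radB => //; exact: radMl.
have Rf3 : R (x3 * x4 - x2 ^+ 4).
  apply: (radX radR (n := 2)).
  have -> : (x3 * x4 - x2 ^+ 4) ^+ 2 =
      x2 ^+ 3 * (x1 * x4 ^+ 2 - 2%:R * x2 * x3 * x4 + x2 ^+ 5)
      - x4 ^+ 2 * (x1 * x2 ^+ 3 - x3 ^+ 2) by ring.
  by apply: radB => //; exact: radMl.
pose Q p := R (x2 * p).
have radQ : radical_ideal Q by exact: rad_colon.
have RQ p : R p -> Q p by exact: radMl.
(* x2 cancels because [R] is radical. Modulo [Q], x3 divides x2^4 and x1 divides x3^2, so their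
   cancellation follows in turn. *)
have can2 p : Q (x2 * p) -> Q p by rewrite /Q mulrA -expr2; apply: radXl.
have can3 p : Q (x3 * p) -> Q p.
  move=> Q3p; apply: (rad_cancelX (n := 4) can2).
  have -> : x2 ^+ 4 * p = x4 * (x3 * p) - p * (x3 * x4 - x2 ^+ 4) by ring.
  by apply: radB => //; apply: radMl => //; exact: RQ.
have can1 p : Q (x1 * p) -> Q p.
  move=> Q1p; apply: (rad_cancelX (n := 2) can3).
  have -> : x3 ^+ 2 * p = x2 ^+ 3 * (x1 * p) - p * (x1 * x2 ^+ 3 - x3 ^+ 2).
    by ring.
  by apply: radB => //; apply: radMl => //; exact: RQ.
have canD p n : Q ((x1 * x2) ^+ n * p) -> Q p.
  by apply: rad_cancelX => q; rewrite -mulrA => /can1/can2.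
have param := fun m1 m2 m3 m4 =>
  surface_monomial m1 m2 m3 m4 radQ (RQ _ Rf1) (RQ _ RF1).
(* This is s^b = u^a with the denominator of u = x3 / (x1 x2) cleared. Modulo [Q], (x1 x2)^(5a)
   times [curve_eq] is x1^(2a) times the fifth power of this binomial. *)
have QB : Q (x1 ^+ b * (x1 * x2) ^+ a - x3 ^+ a).
  apply: (radX radQ (n := 5)); apply: (rad_cancelX (n := a * 2) can1).
  have := param e f h 0%N; have := param a a 0%N 0%N.
  have := param 0%N 0%N a 0%N; have := param 0%N (a * 2)%N 0%N 0%N.
  have := param 0%N 0%N 0%N a.
  rewrite !(muln0, addn0, add0n) /= def_a def_2a.
  rewrite !(expr0, mul1r, mulr1) addnn -!mul2n.
  rewrite (_ : 2 * (a * 2) = a * 4)%N; last by lia.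
  rewrite ![(_ * a)%N]mulnC !exprM.
  move/(radMl radQ (-1)) => Q5.
  move/(radMl radQ (5%:R * x1 ^+ b * (x1 * x2) ^+ a))=> Q4.
  move/(radMl radQ (- 10%:R * x1 ^+ b ^+ 2 * (x1 * x2) ^+ a ^+ 2)) => Q3.
  move/(radMl radQ (10%:R * x1 ^+ b ^+ 3 * (x1 * x2) ^+ a ^+ 3)) => Q2.
  move/(radMl radQ (- 5%:R * x1 ^+ b ^+ 4 * (x1 * x2) ^+ a ^+ 4)) => Q1.
  move/RQ/(radMl radQ ((x1 * x2) ^+ a ^+ 5)): RF3.
  move/(radB radQ)/(_ Q1)/(radB radQ)/(_ Q2)/(radB radQ)/(_ Q3).
  move/(radB radQ)/(_ Q4)/(radB radQ)/(_ Q5).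
  by congr Q; rewrite /curve_eq !exprMn; ring.
move=> m1 m2 m3 m4 n1 n2 n3 n4 eq_w.
set xm := x1 ^+ m1 * _ * _ * _; set xn := x1 ^+ n1 * _ * _ * _.
have Qd : Q (xm - xn).
  rewrite /xm /xn {xm xn}.
  have := param m1 m2 m3 m4; have := param n1 n2 n3 n4.
  move: eq_w; set xm := x1 ^+ m1 * _ * _ * _; set xn := x1 ^+ n1 * _ * _ * _.
  move: (m1 + _ + _ + _)%N (_ + _ + 5 * m4)%N => i j.
  move: (n1 + _ + _ + _)%N (_ + _ + 5 * n4)%N => i' j' /=.
  move: xm xn; wlog le_jj' : i j i' j' / (j <= j')%N => [IH|] xm xn eq_w Qn Qm.
    have [/IH|/ltnW/IH] := leqP j j'; first by move=> {}IH; exact: (IH i i').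
    move/(_ i' i xn xm (esym eq_w) Qm Qn).
    by move/(radN radQ); rewrite opprB.
  (* Equal weights give a (i - i') = b (j' - j). By coprimality the two monomials then differ only
     by exchanging s^(kb) for u^(ka). *)
  have dv : (a %| j' - j)%N.
    rewrite -(Gauss_dvdr _ cop_ab); apply/dvdnP; exists (i - i')%N; nia.
  case/dvdnP: dv => k def_k.
  have {def_k} def_j' : j' = (j + k * a)%N by lia.
  have def_i : i = (i' + k * b)%N by nia.
  subst i j'; apply: (@canD _ (j + k * a)).
  have := rad_congX radQ k QB.
  move/(radMl radQ (x1 ^+ i' * x3 ^+ j)).
  move/(radD radQ)/(_ (radMl radQ ((x1 * x2) ^+ (k * a)) Qm)).
  move/(radB radQ)/(_ Qn); congr Q.
  by rewrite !exprD ![(k * _)%N]mulnC !exprM !exprMn; ring.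
set d := xm - xn in Qd *; have {Qd} R2 : R (x2 * d) by [].
(* From here on, d is shown to be killed by the other variables, hence by
   both monomials of which it is the difference, so that d ^+ 2 is in R. *)
have R3 : R (x3 * d).
  apply: (radX radR (n := 2)).
  have -> : (x3 * d) ^+ 2 =
    x1 * x2 ^+ 2 * d * (x2 * d) - d ^+ 2 * (x1 * x2 ^+ 3 - x3 ^+ 2) by ring.
  by apply: radB => //; apply: radMl.
have R14 : R (x1 * x4 * d).
  have -> : x1 * x4 * d = d * (x1 * x4 - x2 * x3) + x3 * (x2 * d) by ring.
  by apply: radD => //; apply: radMl.
have pw x n : (0 < n)%N -> R (x * d) -> R (x ^+ n * d).
  by case: n => // n _ Rx; rewrite exprSr -mulrA; apply: radMl.
(* Since 2f + 3h = a > 0, this monomial contains x2 or x3. *)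
have RM : R (x1 ^+ e * x2 ^+ f * x3 ^+ h * d).
  have [h0|h0] := posnP h; last first.
    by rewrite -mulrA; apply: (radMl radR); exact: pw.
  have f0 : (0 < f)%N by lia.
  rewrite mulrAC; apply: radMr => //; rewrite -mulrA.
  by apply: (radMl radR); exact: pw.
have R2a := pw _ _ a0 R2; have R3a := pw _ _ a0 R3.
pose mid := - 5%:R * x1 ^+ b ^+ 4 * (x1 ^+ e * x2 ^+ f * x3 ^+ h * d)
     + 10%:R * x1 ^+ b ^+ 3 * x1 ^+ a * (x2 ^+ a * d)
     - 10%:R * x1 ^+ b ^+ 2 * (x3 ^+ a * d)
     + 5%:R * x1 ^+ b * x2 ^+ a * (x2 ^+ a * d).
have Rmid : R mid.
  by apply: radD; [|apply: radB; [|apply: radD|]|] => //; exact: radMl.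
move/(radMl radR d): RF3; rewrite (_ : d * _ =
  x1 ^+ b ^+ 5 * x1 ^+ a ^+ 2 * d + mid - x4 ^+ a * d); last first.
  by rewrite /mid /curve_eq; ring.
move=> RF3.
have {}RF3 : R (x1 ^+ b ^+ 5 * x1 ^+ a ^+ 2 * d - x4 ^+ a * d).
  by move: (radB radR RF3 Rmid); congr R; ring.
(* Only the two extreme terms of [curve_eq] survive: x1^(5b+2a) d and x4^a d agree modulo [R]. As x1
   x4 d is in [R], multiplying by x1 kills the second and multiplying by x4 kills the first. *)
have R1 : R (x1 * d).
  apply: (@radXl _ _ radR _ _ (b * 5 + a * 2).+1).
  rewrite exprS exprD !exprM.
  have -> : x1 * (x1 ^+ b ^+ 5 * x1 ^+ a ^+ 2) * d =
    x1 * (x1 ^+ b ^+ 5 * x1 ^+ a ^+ 2 * d - x4 ^+ a * d)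
    + x4 ^+ a.-1 * (x1 * x4 * d).
    have -> : x4 ^+ a = x4 ^+ a.-1 * x4 by rewrite -exprSr prednK.
    by ring.
  by apply: radD => //; apply: radMl.
have R4 : R (x4 * d).
  apply: (@radXl _ _ radR _ _ a.+1).
  have -> : x4 ^+ a.+1 * d =
    x1 ^+ b ^+ 5 * x1 ^+ a * x1 ^+ a.-1 * (x1 * x4 * d)
    - x4 * (x1 ^+ b ^+ 5 * x1 ^+ a ^+ 2 * d - x4 ^+ a * d).
    have -> : x1 ^+ a ^+ 2 = x1 ^+ a * x1 ^+ a.-1 * x1.
      by rewrite expr2 -mulrA -exprSr prednK.
    by rewrite exprS; ring.
  by apply: radB => //; apply: radMl.
have Rmon k1 k2 k3 k4 : (0 < k1 + k2 + k3 + k4)%N ->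
    R (x1 ^+ k1 * x2 ^+ k2 * x3 ^+ k3 * x4 ^+ k4 * d).
  have [k4_0|/pw/(_ R4) R4k _] := posnP k4.
    have [k3_0|/pw/(_ R3) R3k _] := posnP k3.
      have [k2_0|/pw/(_ R2) R2k _] := posnP k2.
        have [->|/pw/(_ R1) R1k _] := posnP k1; first by rewrite k2_0 k3_0 k4_0.
        by rewrite k2_0 k3_0 k4_0 !mulr1.
      move/(radMl radR (x1 ^+ k1 * x3 ^+ k3 * x4 ^+ k4)): R2k.
      by congr R; ring.
    move/(radMl radR (x1 ^+ k1 * x2 ^+ k2 * x4 ^+ k4)): R3k.
    by congr R; ring.
  move/(radMl radR (x1 ^+ k1 * x2 ^+ k2 * x3 ^+ k3)): R4k.
  by congr R; ring.
(* All weights are positive, so the monomial 1 can only be paired with itself. *)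
have [m0|m_pos] := posnP (m1 + m2 + m3 + m4).
  have [n0|n_pos] := posnP (n1 + n2 + n3 + n4); last by nia.
  suff -> : d = 0 by exact: rad0.
  have [? ? ? ?] : [/\ m1 = n1, m2 = n2, m3 = n3 & m4 = n4] by split; lia.
  by subst; exact: subrr.
have n_pos : (0 < n1 + n2 + n3 + n4)%N by nia.
apply: (radX radR (n := 2)); rewrite expr2 {1}/d mulrBl.
by apply: radB => //; exact: Rmon.
Qed.

End Surface.

(** [P] stands for a power of t. In [curve_eq] every monomial maps to U^2 V^5, and the coefficients
    1, -5, 10, -10, 5, -1 sum to 0. *)
Lemma curve_eqs_vanish (A B : comNzRingType) (phi : {rmorphism A -> B})
    (x1 x2 x3 x4 : A) (P : B) (a b e f h : nat) :
  phi x1 = P ^+ a -> phi x2 = P ^+ (a + 2 * b) ->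
  phi x3 = P ^+ (2 * a + 3 * b) -> phi x4 = P ^+ (2 * a + 5 * b) ->
  (2 * f + 3 * h = a)%N -> (e + f + 2 * h = 2 * a)%N ->
  [/\ phi (x1 * x2 ^+ 3 - x3 ^+ 2) = 0,
      phi (x1 * x4 ^+ 2 - 2%:R * x2 * x3 * x4 + x2 ^+ 5) = 0
    & phi (curve_eq x1 x2 x3 x4 a b e f h) = 0].
Proof.
move=> phi1 phi2 phi3 phi4 def_a def_2a; rewrite /curve_eq.
rewrite !(rmorphB, rmorphD, rmorphM, rmorphXn, rmorph_nat) /=.
rewrite phi1 phi2 phi3 phi4; split.
- by rewrite !exprD; ring.
- by rewrite !exprD; ring.
pose U := P ^+ (a * a); pose V := P ^+ (a * b).
have -> : P ^+ a ^+ b = V by rewrite -exprM.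
have -> : P ^+ a ^+ a = U by rewrite -exprM.
have -> : P ^+ (a + 2 * b) ^+ a = U * V ^+ 2.
  by rewrite -!exprM -exprD; congr (_ ^+ _); ring.
have -> : P ^+ (2 * a + 3 * b) ^+ a = U ^+ 2 * V ^+ 3.
  by rewrite -!exprM -exprD; congr (_ ^+ _); ring.
have -> : P ^+ (2 * a + 5 * b) ^+ a = U ^+ 2 * V ^+ 5.
  by rewrite -!exprM -exprD; congr (_ ^+ _); ring.
have -> : P ^+ a ^+ e * P ^+ (a + 2 * b) ^+ f * P ^+ (2 * a + 3 * b) ^+ h
    = U ^+ 2 * V.
  by rewrite -!exprM -!exprD; congr (_ ^+ _); nia.
by ring.
Qed.

(** * The radical of a finitely generated ideal is the least radical ideal containing the
    generators *)

Section InRadical.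
Variables (K : fieldType) (n : nat) (gs : seq {mpoly K[n]}).

Lemma in_idealD p q : in_ideal gs p -> in_ideal gs q -> in_ideal gs (p + q).
Proof.
move=> [c [_ ->]] [d [_ ->]].
exists (mkseq (fun i => c`_i + d`_i) (size gs)); rewrite size_mkseq; split=> //.
by rewrite -big_split; apply: eq_bigr => i _; rewrite nth_mkseq // mulrDl.
Qed.

Lemma in_idealMl c p : in_ideal gs p -> in_ideal gs (c * p).
Proof.
move=> [d [_ ->]]; exists (mkseq (fun i => c * d`_i) (size gs)).
rewrite size_mkseq; split=> //; rewrite mulr_sumr.
by apply: eq_bigr => i _; rewrite nth_mkseq // mulrA.
Qed.

Lemma in_ideal0 : in_ideal gs 0.
Proof.
exists (nseq (size gs) 0); rewrite size_nseq; split=> //.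
by rewrite big1 // => i _; rewrite nth_nseq if_same mul0r.
Qed.

Lemma in_radical_ideal : radical_ideal (in_radical gs).
Proof.
split=> [|p q [k Ip] [l Iq]|c p [k Ip]|p m [k Ip]].
- by exists 1%N; exact: in_ideal0.
- exists (k + l)%N; rewrite exprDn; apply: big_ind => [|u v|i _].
  + exact: in_ideal0.
  + exact: in_idealD.
  rewrite -mulr_natl; apply: in_idealMl; have [lt_il|le_li] := ltnP i l.
    rewrite mulrC -(subnK (_ : k <= k + l - i)%N); last by lia.
    by rewrite exprD mulrA; exact: in_idealMl.
  by rewrite -[X in q ^+ X](subnK le_li) exprD mulrA; exact: in_idealMl.
- by exists k; rewrite exprMn; exact: in_idealMl.
- by exists (m * k)%N; rewrite exprM.
Qed.

Lemma in_radical_nth i : (i < size gs)%N -> in_radical gs gs`_i.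
Proof.
move=> lt_i; exists 1%N.
exists (mkseq (fun j => (j == i)%:R) (size gs)); rewrite size_mkseq; split=> //.
rewrite (bigD1 (Ordinal lt_i)) //= nth_mkseq // eqxx mul1r big1 ?addr0 //.
move=> j /negPf ne_ji.
by rewrite nth_mkseq // (ne_ji : (j == i :> nat) = _) mul0r.
Qed.

Lemma in_radical_sub (Q : {mpoly K[n]} -> Prop) p :
  radical_ideal Q -> (forall g, g \in gs -> Q g) -> in_radical gs p -> Q p.
Proof.
move=> radQ Qgs [k [c [_ def_pk]]]; apply: (radX radQ (n := k)).
rewrite def_pk; apply: rad_sum => // i _; apply: radMl => //.
exact/Qgs/mem_nth.
Qed.

End InRadical.

(** * Toric ideals and their binomials *)

Definition wdeg (n : nat) (w : 'I_n -> nat) (m : 'X_{1..n}) : nat :=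
  (\sum_(i < n) w i * m i)%N.

Section ToricIdeal.
Variables (K : fieldType) (n : nat) (w : 'I_n -> nat).

Lemma toric_radical_ideal : radical_ideal (@toric_ideal K n w).
Proof.
split=> [|p q|c p|p k]; rewrite /toric_ideal.
- by rewrite raddf0.
- by move=> p0 q0; rewrite raddfD /= p0 q0 addr0.
- by move=> p0; rewrite rmorphM /= p0 mulr0.
- by rewrite rmorphXn /= => /eqP; rewrite expf_eq0 => /andP[_ /eqP].
Qed.

(* Subtracting from each monomial of p the representative of its degree changes
   p by a sum of binomials and leaves 0. *)
Lemma toric_ideal_sub (R : {mpoly K[n]} -> Prop) p :
  radical_ideal R ->
  (forall m m', wdeg w m = wdeg w m' -> R ('X_[m] - 'X_[m'])) ->
  toric_ideal w p -> R p.
Proof.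
move=> radR Rbin p0; pose s := msupp p.
pose rep d : {mpoly K[n]} := 'X_[nth 0%MM s (find (fun m => wdeg w m == d) s)].
pose N := (\max_(m <- s) wdeg w m).+1.
(* Grouped by weight d, the coefficients of [p] add up to the coefficient of t^d in its image, which
   is 0. *)
have rep0 : \sum_(m <- s) p@_m *: rep (wdeg w m) = 0.
  transitivity (\sum_(d < N)
      (mmap (@polyC K) (fun i => 'X^(w i)) p)`_d *: rep d).
    under [RHS]eq_bigr => d _ do rewrite coef_sum scaler_suml.
    rewrite exchange_big /= big_seq [RHS]big_seq; apply: eq_bigr => m s_m.
    have lt_mN : (wdeg w m < N)%N by rewrite ltnS; exact: leq_bigmax_seq.
    have coef_m d : ((p@_m)%:P * mmap1 (fun i => 'X^(w i)) m)`_d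
        = p@_m * (d == wdeg w m)%:R.
      rewrite coefCM /mmap1; congr (_ * _); rewrite -coefXn; congr (_`_d).
      by under eq_bigr => i _ do rewrite -exprM; rewrite -expr_sum.
    rewrite (bigD1 (Ordinal lt_mN)) //= coef_m eqxx mulr1 big1 ?addr0 // => d.
    move=> /negPf ne_d.
    by rewrite coef_m (ne_d : (d == _ :> nat) = _) mulr0 scale0r.
  by rewrite p0; apply: big1 => d _; rewrite coef0 scale0r.
rewrite -[p]subr0 -rep0 {1}[p]mpolyE -sumrB big_seq.
apply: rad_sum => // m s_m; rewrite -scalerBr -mul_mpolyC; apply: radMl => //.
apply: Rbin; have has_m : has (fun m' => wdeg w m' == wdeg w m) s.
  by apply/hasP; exists m.
by rewrite (eqP (nth_find 0%MM has_m)).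
Qed.

End ToricIdeal.

(** * The monomial curves in four variables *)

Section MonomialCurve.
Variable K : fieldType.
Let o1 : 'I_4 := @Ordinal 4 0 isT.
Let o2 : 'I_4 := @Ordinal 4 1 isT.
Let o3 : 'I_4 := @Ordinal 4 2 isT.
Let o4 : 'I_4 := @Ordinal 4 3 isT.
Local Notation x1 := ('X_o1 : {mpoly K[4]}).
Local Notation x2 := ('X_o2 : {mpoly K[4]}).
Local Notation x3 := ('X_o3 : {mpoly K[4]}).
Local Notation x4 := ('X_o4 : {mpoly K[4]}).

Lemma big_ord4 (T : Type) (idx : T) (op : Monoid.law idx) (F : 'I_4 -> T) :
  \big[op/idx]_i F i = op (op (op (F o1) (F o2)) (F o3)) (F o4).
Proof.
rewrite !big_ord_recr big_ord0 /= Monoid.mul1m.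
by congr (op (op (op _ _) _) _); congr F; exact: val_inj.
Qed.

Lemma mpolyX4 (m : 'X_{1..4}) :
  'X_[m] = x1 ^+ m o1 * x2 ^+ m o2 * x3 ^+ m o3 * x4 ^+ m o4.
Proof. by rewrite mpolyXE_id big_ord4. Qed.

Lemma wdeg_Mab (a b : nat) (m : 'X_{1..4}) :
  wdeg (Mab a b) m = (a * (m o1 + m o2 + 2 * m o3 + 2 * m o4)
                      + b * (2 * m o2 + 3 * m o3 + 5 * m o4))%N.
Proof. by rewrite /wdeg big_ord4 /Mab /=; ring. Qed.

Lemma mmap_var (w : 'I_4 -> nat) i :
  mmap (@polyC K) (fun i => 'X^(w i)) ('X_i : {mpoly K[4]}) = 'X^(w i).
Proof. by rewrite mmapX mmap1U. Qed.

(** The first weight divides the others, so modulo the equations every monomial is a power of x1,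
    whose exponent [deg] is the weight divided by [g]. *)
Lemma graph_curve_CI (g b : nat) : (0 < g)%N ->
  is_set_theoretic_CI_with 3
    (toric_ideal (Mab g (b * g)) : {mpoly K[4]} -> Prop).
Proof.
move=> g0; exists [:: x2 - x1 ^+ (1 + 2 * b); x3 - x1 ^+ (2 + 3 * b);
                     x4 - x1 ^+ (2 + 5 * b)].
split=> // p; split; last first.
  move=> Rp; apply: in_radical_sub (toric_radical_ideal _ _) _ Rp => q.
  rewrite !inE /toric_ideal => /or3P[] /eqP-> {q};
    rewrite rmorphB rmorphXn /= !mmap_var /Mab /= -exprM;
    by apply/eqP; rewrite subr_eq0; apply/eqP; congr (_ ^+ _); ring.
set gs := [:: _; _; _]; have radR := in_radical_ideal gs.
have [R2 R3 R4] : [/\ in_radical gs (x2 - x1 ^+ (1 + 2 * b)),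
    in_radical gs (x3 - x1 ^+ (2 + 3 * b))
    & in_radical gs (x4 - x1 ^+ (2 + 5 * b))].
  split; [exact: (@in_radical_nth _ _ gs 0) | exact: (@in_radical_nth _ _ gs 1)
         | exact: (@in_radical_nth _ _ gs 2)].
pose deg (m : 'X_{1..4}) :=
  (m o1 + (1 + 2 * b) * m o2 + (2 + 3 * b) * m o3 + (2 + 5 * b) * m o4)%N.
have red m : in_radical gs ('X_[m] - x1 ^+ deg m).
  have := rad_congM radR (rad_congM radR (rad_congX radR (m o2) R2)
    (rad_congX radR (m o3) R3)) (rad_congX radR (m o4) R4).
  move/(radMl radR (x1 ^+ m o1)); congr in_radical.
  rewrite (mpolyX4 m) /deg.
  move: (1 + 2 * b)%N (2 + 3 * b)%N (2 + 5 * b)%N => c2 c3 c4.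
  by rewrite !exprD !exprM; ring.
apply: toric_ideal_sub => // m m'; rewrite !wdeg_Mab => eq_w.
have eq_deg : deg m = deg m'.
  by apply/eqP; rewrite -(eqn_pmul2l g0); apply/eqP; rewrite /deg; nia.
by move: (radB radR (red m) (red m')); rewrite eq_deg; congr in_radical; ring.
Qed.

(** The common factor [g] merely replaces t by t^g; cancelling it from the weights reduces to the
    coprime case. *)
Lemma monomial_curve_STCI (g a b e f h : nat) :
  (0 < g)%N -> (0 < a)%N -> (0 < b)%N -> coprime a b ->
  (2 * f + 3 * h = a)%N -> (e + f + 2 * h = 2 * a)%N ->
  is_set_theoretic_CI_with 3
    (toric_ideal (Mab (a * g) (b * g)) : {mpoly K[4]} -> Prop).
Proof.
move=> g0 a0 b0 cop_ab def_a def_2a.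
exists [:: x1 * x2 ^+ 3 - x3 ^+ 2;
           x1 * x4 ^+ 2 - 2%:R * x2 * x3 * x4 + x2 ^+ 5;
           curve_eq x1 x2 x3 x4 a b e f h].
split=> // p; split; last first.
  move=> Rp; apply: in_radical_sub (toric_radical_ideal _ _) _ Rp => q.
  have wt c i : Mab (a * g) (b * g) i = (c * g)%N ->
      mmap (@polyC K) (fun i => 'X^(Mab (a * g) (b * g) i))
        ('X_i : {mpoly K[4]}) = 'X^g ^+ c.
    by move=> def_i; rewrite mmap_var def_i mulnC exprM.
  have [||||F1 F2 F3] := curve_eqs_vanish (wt a o1 _) (wt (a + 2 * b)%N o2 _)
    (wt (2 * a + 3 * b)%N o3 _) (wt (2 * a + 5 * b)%N o4 _) def_a def_2a;
    try by rewrite /Mab /=; ring.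
  by rewrite !inE => /or3P[] /eqP->.
set gs := [:: _; _; _]; have radR := in_radical_ideal gs.
apply: toric_ideal_sub => // m m'; rewrite !wdeg_Mab.
rewrite (mpolyX4 m) (mpolyX4 m') => eq_w.
apply: (curve_binomial radR a0 b0 cop_ab def_a def_2a);
  [exact: (@in_radical_nth _ _ gs 0) | exact: (@in_radical_nth _ _ gs 1)
  | exact: (@in_radical_nth _ _ gs 2) |].
by apply/eqP; rewrite -(eqn_pmul2r g0); apply/eqP; nia.
Qed.

End MonomialCurve.

(* The toric ideal of M_{a,b} in K[x1..x4] (height 3) is a set-theoretic
   complete intersection: it equals rad(g1,g2,g3). *)
Theorem theorem6p2 (K : fieldType) (a b : nat) :
  (0 < a)%N -> (0 < b)%N ->
  is_set_theoretic_CI_with 3 (toric_ideal (Mab a b) : {mpoly K[4]} -> Prop).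
Proof.
move=> a0 b0; have g0 : (0 < gcdn a b)%N by rewrite gcdn_gt0 a0.
(* [a %| b] is the case a' = 1, in which 2f + 3h = a' has no solution. *)
have [/dvdnP[c ->]|ndv_ab] := boolP (a %| b)%N; first exact: graph_curve_CI.
have /dvdnP[c def_a] := dvdn_gcdl a b; have /dvdnP[d def_b] := dvdn_gcdr a b.
case def_g: (gcdn a b) g0 def_a def_b => [//|g'] g0.
move: g'.+1 def_g g0 => g + g0 def_a def_b; subst a b => def_g.
have cop : coprime c d.
  by rewrite /coprime -(eqn_pmul2r g0) mul1n muln_gcdl def_g.
have c_gt1 : (1 < c)%N.
  case: c {def_g cop} a0 ndv_ab => [|[|c]] // _.
  by rewrite mul1n dvdn_mull.
(* To solve 2f + 3h = c, take for h the parity of c, then f = (c - 3h)/2 and e = 2c - f - 2h. An odd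
   c > 1 is at least 3, so no subtraction truncates. *)
apply: (@monomial_curve_STCI _ _ _ _
  (2 * c - (c - 3 * odd c)./2 - 2 * odd c) (c - 3 * odd c)./2 (odd c)) => //;
  lia.
Qed.
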